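(* Let $q$ be a prime power, $n\ge2$, $m\ge1$, and let $\mathcal C\subseteq\mathbb F_q^{n\times m}$ be a nondegenerate $\mathbb F_q$-linear subspace of dimension $k$ with generator tensor $T\in\mathbb F_q^{k\times n\times m}$. Let $N=(q^n-1)/(q-1)$, let $u_1,\dots,u_N\in\mathbb F_q^n\setminus\{0\}$ be representatives of the points of the projective space $\mathbb P(\mathbb F_q^n)$, set $M_i:=m_2(u_i,T)\in\mathbb F_q^{k\times m}$, and let $\mathcal C^{\mathrm{AH}}$ be the row space of the block matrix $(M_1\ M_2\ \cdots\ M_N)\in\mathbb F_q^{k\times mN}$. Then the projectivization $\operatorname{Proj}(\mathcal M[\mathcal C])$ is equivalent to the polymatroid induced by $\mathcal C^{\mathrm{AH}}$; that is, the bijection $\psi:\mathbb P(\mathbb F_q^n)\to[N]$, $\langle u_i\rangle\mapsto i$, satisfies $r_{\operatorname{Proj}(\mathcal M[\mathcal C])}(A)=r_{\mathcal C^{\mathrm{AH}}}(\psi(A))$ for all $A\subseteq\mathbb P(\mathbb F_q^n)$.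
   Context: For $W\subseteq\mathbb F_q^n$, $\mathcal C(W)=\{M\in\mathcal C:\operatorname{colsp}(M)\subseteq W\}$; $\mathcal M[\mathcal C]$ is the $q$-polymatroid on $\mathbb F_q^n$ with rank function $\rho_{\mathcal C}(U)=(k-\dim\mathcal C(U^\perp))/m$, where $U^\perp$ is the orthogonal complement under the standard dot product. $\mathcal C$ is nondegenerate if the sum of the column spaces of its elements is $\mathbb F_q^n$ and the sum of their row spaces is $\mathbb F_q^m$. A tensor $T\in\mathbb F_q^{k\times n\times m}$ with entries $T_{a,b,c}$ is a generator tensor of $\mathcal C$ if the $\mathbb F_q$-span of the $k$ matrices $(T_{a,b,c})_{b,c}\in\mathbb F_q^{n\times m}$ equals $\mathcal C$. For a row vector $u\in\mathbb F_q^n$, $m_2(u,T)\in\mathbb F_q^{k\times m}$ is the matrix with entries $\sum_{b}u_bT_{a,b,c}$. The projectivization $\operatorname{Proj}(\mathcal M)$ of a $q$-polymatroid $(\mathcal L(\mathbb F_q^n),\rho)$ is the polymatroid on ground set $\mathbb P(\mathbb F_q^n)$ with rank $r(A)=\rho(\langle A\rangle)$, $\langle A\rangle$ the span of representatives of the points in $A$. The polymatroid induced by $\mathcal C^{\mathrm{AH}}$ is on $[N]$ with rank function $r_{\mathcal C^{\mathrm{AH}}}(\{i_1,\dots,i_s\})=\frac1m\dim_{\mathbb F_q}\operatorname{rowsp}(M_{i_1}\ \cdots\ M_{i_s})$ (and $0$ on the empty set). *)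

(* Defs.v *)
From HB Require Import structures.
From mathcomp Require Import all_boot all_order all_algebra.
Set Implicit Arguments.
Unset Strict Implicit.
Unset Printing Implicit Defensive.
Import Order.TTheory GRing.Theory Num.Theory.
Local Open Scope ring_scope.

(* Makes {set point F n} below the type of all sets of projective points. *)
HB.instance Definition _ (F : finFieldType) (vT : vectType F) :=
  Countable.copy {vspace vT} (can_type (@VectorInternalTheory.vs2mxK F vT)).
HB.instance Definition _ (F : finFieldType) (vT : vectType F) :
    isFinite {vspace vT} :=
  CanIsFinite (@VectorInternalTheory.vs2mxK F vT).

Record polymatroid (E : finType) := Polymatroid {
  prank :> {set E} -> rat;
  prank_bounds : forall A : {set E}, 0 <= prank A <= #|A|%:R;
  prank_mono : forall A B : {set E}, A \subset B -> prank A <= prank B;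
  prank_submod : forall A B : {set E},
    prank (A :|: B) + prank (A :&: B) <= prank A + prank B }.

Record qpolymatroid (F : finFieldType) (n : nat) := QPolymatroid {
  qrank :> {vspace 'rV[F]_n} -> rat;
  qrank_bounds : forall U : {vspace 'rV[F]_n}, 0 <= qrank U <= (\dim U)%:R;
  qrank_mono : forall U V : {vspace 'rV[F]_n},
    (U <= V)%VS -> qrank U <= qrank V;
  qrank_submod : forall U V : {vspace 'rV[F]_n},
    qrank (U + V)%VS + qrank (U :&: V)%VS <= qrank U + qrank V }.

Definition polymatroid_equiv (E E' : finType) (psi : E -> E')
    (M : polymatroid E) (M' : polymatroid E') : Prop :=
  bijective psi /\ forall A : {set E}, M A = M' (psi @: A).

Definition rowsp (F : fieldType) (k n : nat) (A : 'M[F]_(k, n)) :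
    {vspace 'rV[F]_n} :=
  <<[seq row i A | i : 'I_k]>>%VS.

(* Columns are transposed, so that the ambient space F^n is always 'rV[F]_n. *)
Definition colsp (F : fieldType) (n m : nat) (A : 'M[F]_(n, m)) :
    {vspace 'rV[F]_n} :=
  <<[seq (col j A)^T | j : 'I_m]>>%VS.

Lemma rowsp_limg (F : fieldType) (k n : nat) (A : 'M[F]_(k, n)) :
  rowsp A = limg (linfun (mulmxr A : 'rV_k -> 'rV_n)).
Proof.
apply/eqP; rewrite eqEsubv; apply/andP; split.
  apply/span_subvP => _ /imageP[i _ ->]; apply/memv_imgP.
  by exists (delta_mx 0 i); rewrite ?memvf // lfunE /= rowE.
apply/subvP => _ /memv_imgP[w _ ->]; rewrite lfunE /= mulmx_sum_row.
by apply: memv_suml => i _; apply/memvZ/memv_span/imageP; exists i.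
Qed.

Lemma rowspP (F : fieldType) (k n : nat) (A : 'M[F]_(k, n)) (v : 'rV_n) :
  reflect (exists w : 'rV_k, v = w *m A) (v \in rowsp A).
Proof.
rewrite rowsp_limg; apply: (iffP memv_imgP) => [[w _ ->]|[w ->]]; exists w.
- by rewrite lfunE.
- exact: memvf.
- by rewrite lfunE.
Qed.

Lemma dim_rowsp (F : fieldType) (k n : nat) (A : 'M[F]_(k, n)) :
  \dim (rowsp A) = \rank A.
Proof.
have -> : rowsp A = rowsp (row_base A).
  apply/vspaceP => v; apply/rowspP/rowspP => -[w ->]; apply/submxP.
    by rewrite eq_row_base submxMl.
  by rewrite -(eq_row_base A) submxMl.
rewrite rowsp_limg limg_dim_eq ?dimvf ?dim_matrix; first exact: mul1n.
apply/eqP; rewrite -subv0; apply/subvP => w.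
rewrite memv_cap memvf /= memv_ker lfunE /= memv0.
by rewrite -(mul0mx _ (row_base A)) (inj_eq (row_free_inj (row_base_free A))).
Qed.

Lemma colsp_tr (F : fieldType) (n m : nat) (A : 'M[F]_(n, m)) :
  colsp A = rowsp A^T.
Proof.
by rewrite /colsp /rowsp; congr span; apply: eq_map => j; rewrite tr_col.
Qed.

Lemma dim_colsp (F : fieldType) (n m : nat) (A : 'M[F]_(n, m)) :
  \dim (colsp A) = \rank A.
Proof. by rewrite colsp_tr dim_rowsp mxrank_tr. Qed.

Lemma colsp_mxrow (F : fieldType) (k m s : nat) (M : 'I_s -> 'M[F]_(k, m)) :
  colsp (\mxrow_(j < s) M j) = (\sum_(j < s) colsp (M j))%VS.
Proof.
apply/eqP; rewrite eqEsubv; apply/andP; split.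
  apply/span_subvP => _ /imageP[j _ ->].
  rewrite col_mxrow; set i := tagnat.sig1 j; set c := tagnat.sig2 j.
  apply: (subvP (sumv_sup i _ (subvv _))) => //.
  by apply/memv_span/imageP; exists c.
apply/subv_sumP => i _; apply/span_subvP => _ /imageP[c _ ->].
apply/memv_span/imageP; exists (tagnat.Rank i c) => //.
rewrite -[in LHS](@mxrowK _ _ (fun=> m) k M i).
by apply/rowP => a; rewrite !mxE.
Qed.

Section Codes.
Variables (F : finFieldType) (n m : nat).
Implicit Types (U V W : {vspace 'rV[F]_n}) (C : {vspace 'M[F]_(n, m)}).

(* The set spanned is already a subspace, see [mem_orthov]. *)
Definition orthov U : {vspace 'rV[F]_n} :=
  <<enum [set v : 'rV[F]_n |
            [forall u : 'rV[F]_n, (u \in U) ==> (u *m v^T == 0)%R]]>>%VS.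

Lemma mem_orthov U (v : 'rV[F]_n) :
  reflect (forall u, u \in U -> u *m v^T = 0) (v \in orthov U).
Proof.
apply: (iffP idP) => [vU u uU|h]; last first.
  apply: memv_span; rewrite mem_enum inE; apply/forallP => u.
  by apply/implyP => /h ->.
rewrite (coord_span vU) linear_sum /= mulmx_sumr big1 // => i _.
rewrite linearZ /= -scalemxAr.
set s := enum _; have lti: (i < size s)%N by rewrite -cardE ltn_ord.
have := mem_nth 0 lti.
by rewrite mem_enum inE => /forallP/(_ u); rewrite uU => /eqP ->; rewrite scaler0.
Qed.

(* C(W); the set spanned is already a subspace, see [mem_subcode]. *)
Definition subcode C W : {vspace 'M[F]_(n, m)} :=
  <<enum [set X : 'M[F]_(n, m) | (X \in C) && (colsp X <= W)%VS]>>%VS.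

Lemma colsp_subP W (X : 'M[F]_(n, m)) :
  reflect (forall w : 'cV_m, (X *m w)^T \in W) (colsp X <= W)%VS.
Proof.
rewrite colsp_tr; apply: (iffP subvP) => [h w|h _ /rowspP[w ->]].
  by apply: h; apply/rowspP; exists w^T; rewrite trmx_mul.
by rewrite -[w]trmxK -trmx_mul.
Qed.

Lemma mem_subcode C W (X : 'M[F]_(n, m)) :
  (X \in subcode C W) = (X \in C) && (colsp X <= W)%VS.
Proof.
apply/idP/idP => [XC|h]; last by apply: memv_span; rewrite mem_enum inE.
have P i (s := enum [set X : 'M[F]_(n, m) | (X \in C) && (colsp X <= W)%VS]) :
    (i < #|[set X : 'M[F]_(n, m) | (X \in C) && (colsp X <= W)%VS]|)%N ->
    (s`_i \in C) && (colsp s`_i <= W)%VS.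
  by rewrite cardE => lti; have := mem_nth 0 lti; rewrite mem_enum inE.
rewrite (coord_span XC); apply/andP; split.
  by apply: memv_suml => i _; apply: memvZ; case/andP: (P i (ltn_ord i)).
apply/colsp_subP => w; rewrite mulmx_suml linear_sum /=.
apply: memv_suml => i _; rewrite -scalemxAl linearZ /=; apply: memvZ.
by case/andP: (P i (ltn_ord i)) => _ /colsp_subP.
Qed.

Definition nondegenerate_code C : Prop :=
  (\sum_(X : 'M[F]_(n, m) | X \in C) colsp X)%VS = fullv /\
  (\sum_(X : 'M[F]_(n, m) | X \in C) rowsp X)%VS = fullv.

Definition code_rho C U : rat :=
  ((\dim C)%:R - (\dim (subcode C (orthov U)))%:R) / m%:R.

Lemma orthovS U V : (U <= V)%VS -> (orthov V <= orthov U)%VS.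
Proof.
move=> /subvP UV; apply/subvP => v /mem_orthov h.
by apply/mem_orthov => u /UV/h.
Qed.

Lemma subcodeS C V W : (V <= W)%VS -> (subcode C V <= subcode C W)%VS.
Proof.
move=> VW; apply/subvP => X; rewrite !mem_subcode => /andP[-> h] /=.
exact: subv_trans h VW.
Qed.

Lemma subcode_sub C W : (subcode C W <= C)%VS.
Proof. by apply/subvP => X; rewrite mem_subcode => /andP[]. Qed.

Lemma dim_subcode_bound C U :
  (\dim C <= \dim U * m + \dim (subcode C (orthov U)))%N.
Proof.
pose B : 'M[F]_(\dim U, n) := \matrix_i (vbasis U)`_i.
pose f := linfun (mulmx B : 'M[F]_(n, m) -> 'M_(\dim U, m)).
rewrite -(limg_ker_dim f C) addnC leq_add //.
  by rewrite (leq_trans (dimvS (subvf _))) // dimvf dim_matrix.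
apply: dimvS; apply/subvP => X.
rewrite memv_cap memv_ker lfunE /= mem_subcode => /andP[-> /eqP BX] /=.
apply/colsp_subP => w; apply/mem_orthov => u uU; rewrite trmxK.
rewrite (coord_vbasis uU) mulmx_suml big1 // => i _.
have -> : (vbasis U)`_i = row i B by rewrite rowK.
by rewrite -scalemxAl mulmxA -row_mul BX row0 mul0mx scaler0.
Qed.

Fact code_rho_bounds C U : 0 <= code_rho C U <= (\dim U)%:R.
Proof.
rewrite /code_rho; have [m0|m0] := posnP m.
  have -> : m%:R = 0 :> rat by rewrite m0.
  by rewrite invr0 mulr0 lexx ler0n.
rewrite divr_ge0 ?ler0n ?subr_ge0 ?ler_nat ?dimvS ?subcode_sub //=.
rewrite ler_pdivrMr ?ltr0n // lerBlDr -natrM -natrD ler_nat.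
exact: dim_subcode_bound.
Qed.

Fact code_rho_mono C U V : (U <= V)%VS -> code_rho C U <= code_rho C V.
Proof.
move=> UV; rewrite /code_rho ler_wpM2r ?invr_ge0 ?ler0n // lerD2l lerN2 ler_nat.
exact/dimvS/subcodeS/orthovS.
Qed.

Fact code_rho_submod C U V :
  code_rho C (U + V)%VS + code_rho C (U :&: V)%VS <= code_rho C U + code_rho C V.
Proof.
rewrite /code_rho -!mulrDl ler_wpM2r ?invr_ge0 ?ler0n //.
rewrite addrACA [leRHS]addrACA lerD2l -!opprD lerN2 -!natrD ler_nat.
rewrite -dimv_sum_cap addnC leq_add //; apply: dimvS.
  apply/subvP => X; rewrite memv_cap !mem_subcode.
  case/andP=> /andP[-> /subvP hU] /andP[_ /subvP hV] /=.
  apply/subvP => v vX; apply/mem_orthov => _ /memv_addP[u uU [w wV ->]].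
  move/mem_orthov: (hU _ vX) => /(_ _ uU); move/mem_orthov: (hV _ vX) => /(_ _ wV).
  by rewrite mulmxDl => -> ->; rewrite addr0.
by rewrite subv_add !subcodeS ?orthovS ?capvSl ?capvSr.
Qed.

Definition code_qpolymatroid C : qpolymatroid F n :=
  QPolymatroid (code_rho_bounds C) (@code_rho_mono C) (@code_rho_submod C).

End Codes.

Section Tensors.
Variables (F : finFieldType) (k n m : nat).

Definition tensor := 'I_k -> 'I_n -> 'I_m -> F.

Definition slice1 (T : tensor) (a : 'I_k) : 'M[F]_(n, m) :=
  \matrix_(b, c) T a b c.

Definition generator_tensor (C : {vspace 'M[F]_(n, m)}) (T : tensor) : Prop :=
  <<[seq slice1 T a | a : 'I_k]>>%VS = C.

Definition m2 (u : 'rV[F]_n) (T : tensor) : 'M[F]_(k, m) :=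
  \matrix_(a, c) \sum_(b < n) u 0 b * T a b c.

End Tensors.

Section Projectivization.
Variables (F : finFieldType) (n : nat).

Definition point := {P : {vspace 'rV[F]_n} | \dim P == 1%N}.

HB.instance Definition _ :=
  SubFinite.copy point {P : {vspace 'rV[F]_n} | \dim P == 1%N}.

Fact line_subproof (u : 'rV[F]_n) : u != 0 -> \dim <[u]>%VS == 1%N.
Proof. by rewrite dim_vline => ->. Qed.

Definition point_of (u : 'rV[F]_n) (hu : u != 0) : point :=
  exist _ <[u]>%VS (line_subproof hu).

Definition point_rep (P : point) : 'rV[F]_n := vpick (val P).

Definition pspan (A : {set point}) : {vspace 'rV[F]_n} :=
  <<[seq point_rep P | P in A]>>%VS.

Lemma line_point_rep (P : point) : <[point_rep P]>%VS = val P.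
Proof.
apply/eqP; rewrite eqEdim -memvE memv_pick /= dim_vline vpick0 -dimv_eq0.
by rewrite (eqP (valP P)).
Qed.

(* The span does not depend on the chosen representatives. *)
Lemma pspanE (A : {set point}) : pspan A = (\sum_(P in A) val P)%VS.
Proof.
rewrite /pspan span_def big_image /=.
by apply: eq_bigr => P _; rewrite line_point_rep.
Qed.

Lemma pspanS (A B : {set point}) : A \subset B -> (pspan A <= pspan B)%VS.
Proof.
move=> /subsetP AB; rewrite !pspanE; apply/subv_sumP => P /AB PB.
exact: (sumv_sup P).
Qed.

Variable M : qpolymatroid F n.

Fact proj_bounds (A : {set point}) : 0 <= M (pspan A) <= #|A|%:R.
Proof.
case/andP: (qrank_bounds M (pspan A)) => -> /= /le_trans -> //.
by rewrite ler_nat (leq_trans (dim_span _)) // size_image.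
Qed.

Fact proj_mono (A B : {set point}) :
  A \subset B -> M (pspan A) <= M (pspan B).
Proof. by move=> AB; apply/qrank_mono/pspanS. Qed.

Fact proj_submod (A B : {set point}) :
  M (pspan (A :|: B)) + M (pspan (A :&: B)) <= M (pspan A) + M (pspan B).
Proof.
apply: le_trans (qrank_submod M _ _); apply: lerD; apply: qrank_mono.
  rewrite !pspanE; apply/subv_sumP => P; rewrite inE => /orP[] PA.
    by apply: subv_trans (addvSl _ _); apply: (sumv_sup P).
  by apply: subv_trans (addvSr _ _); apply: (sumv_sup P).
by rewrite subv_cap !pspanS ?subsetIl ?subsetIr.
Qed.

Definition Proj : polymatroid point :=
  Polymatroid proj_bounds proj_mono proj_submod.

End Projectivization.

Section BlockCode.
Variables (F : finFieldType) (k m N : nat).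
Implicit Types (M : 'I_N -> 'M[F]_(k, m)) (S : {set 'I_N}).

(* [enum_val] lists S in increasing order; for S empty the block matrix has
   no columns and its row space is 0. *)
Definition block_rank M S : rat :=
  (\dim (rowsp (\mxrow_(j < #|S|) M (enum_val j))))%:R / m%:R.

Lemma block_rankE M S :
  block_rank M S = (\dim (\sum_(i in S) colsp (M i))%VS)%:R / m%:R.
Proof.
rewrite /block_rank dim_rowsp -dim_colsp colsp_mxrow.
by rewrite [in RHS](big_enum_val (A := mem S) (fun i => colsp (M i))).
Qed.

Lemma sum_colspS M S S' : S \subset S' ->
  (\sum_(i in S) colsp (M i) <= \sum_(i in S') colsp (M i))%VS.
Proof.
move=> /subsetP SS; apply/subv_sumP => i /SS iS; exact: (sumv_sup i).
Qed.

Fact block_rank_bounds M S : 0 <= block_rank M S <= #|S|%:R.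
Proof.
rewrite block_rankE divr_ge0 ?ler0n //=; have [m0|m0] := posnP m.
  have -> : m%:R = 0 :> rat by rewrite m0.
  by rewrite invr0 mulr0 ler0n.
rewrite ler_pdivrMr ?ltr0n // -natrM ler_nat.
rewrite (leq_trans (dimv_leq_sum _ _ _)) // -sum_nat_const leq_sum // => i _.
by rewrite (leq_trans (dim_span _)) // size_image card_ord.
Qed.

Fact block_rank_mono M S S' : S \subset S' -> block_rank M S <= block_rank M S'.
Proof.
move=> SS; rewrite !block_rankE ler_wpM2r ?invr_ge0 ?ler0n // ler_nat.
exact/dimvS/sum_colspS.
Qed.

Fact block_rank_submod M S S' :
  block_rank M (S :|: S') + block_rank M (S :&: S')
    <= block_rank M S + block_rank M S'.
Proof.
rewrite !block_rankE -!mulrDl ler_wpM2r ?invr_ge0 ?ler0n // -!natrD ler_nat.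
rewrite -[leqRHS]dimv_sum_cap leq_add //; apply: dimvS; last first.
  by rewrite subv_cap !sum_colspS ?subsetIl ?subsetIr.
apply/subv_sumP => i; rewrite inE => /orP[] iS.
  by apply: subv_trans (addvSl _ _); apply: (sumv_sup i).
by apply: subv_trans (addvSr _ _); apply: (sumv_sup i).
Qed.

(* The polymatroid induced by a code D in F^(mN), given as the row space of a
   block matrix (M_1 ... M_N); it depends on D only, see
   [induced_polymatroid_unique]. *)
Definition induced_polymatroid (D : {vspace 'rV[F]_(\sum_(i < N) m)}) M
    (hM : rowsp (\mxrow_(i < N) M i) = D) : polymatroid 'I_N :=
  Polymatroid (block_rank_bounds M) (@block_rank_mono M) (@block_rank_submod M).

End BlockCode.

Lemma induced_polymatroid_unique (F : finFieldType) (k k' m N : nat)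
    (D : {vspace 'rV[F]_(\sum_(i < N) m)})
    (M : 'I_N -> 'M[F]_(k, m)) (hM : rowsp (\mxrow_(i < N) M i) = D)
    (M' : 'I_N -> 'M[F]_(k', m)) (hM' : rowsp (\mxrow_(i < N) M' i) = D)
    (S : {set 'I_N}) :
  induced_polymatroid hM S = induced_polymatroid hM' S.
Proof.
suff sub l l' (A : 'I_N -> 'M[F]_(l, m)) (B : 'I_N -> 'M[F]_(l', m)) :
    rowsp (\mxrow_(i < N) A i) = rowsp (\mxrow_(i < N) B i) ->
    (rowsp (\mxrow_(j < #|S|) A (enum_val j))
      <= rowsp (\mxrow_(j < #|S|) B (enum_val j)))%VS.
  rewrite /= /block_rank; congr (_%:R / _); congr (\dim _); apply/eqP.
  by rewrite eqEsubv !sub // hM hM'.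
move=> AB; apply/subvP => _ /rowspP[w ->].
have: w *m (\mxrow_(i < N) A i) \in rowsp (\mxrow_(i < N) B i).
  by rewrite -AB; apply/rowspP; exists w.
case/rowspP=> w'; rewrite !mul_mxrow => /eq_mxrowP E.
by apply/rowspP; exists w'; rewrite !mul_mxrow; apply/eq_mxrowP => j.
Qed.

(* Main.v *)
(** Stacking the products [u_j *m X] is a linear map [f] on the code that sends
    the [a]-th slice of the generator tensor to the [a]-th row of
    [(M_1 ... M_s)], so it maps the code onto the row space of this matrix. Its
    kernel in the code is the subcode of the matrices whose columns are
    orthogonal to all the [u_j], and rank-nullity gives the equality of ranks. *)
Require Import Defs.
From HB Require Import structures.
From mathcomp Require Import all_boot all_order all_algebra.
Set Implicit Arguments.
Unset Strict Implicit.
Unset Printing Implicit Defensive.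
Import Order.TTheory GRing.Theory Num.Theory.
Local Open Scope ring_scope.

(** The products are concatenated into one row vector so that the image lies in the ambient space of
    [rowsp] of the block matrix. *)
Definition block_mulmx (F : fieldType) (n m s : nat) (v : 'I_s -> 'rV[F]_n)
    (X : 'M[F]_(n, m)) : 'rV[F]_(\sum_(j < s) m) :=
  \mxrow_(j < s) (v j *m X).

Fact block_mulmx_is_linear (F : fieldType) (n m s : nat)
    (v : 'I_s -> 'rV[F]_n) : linear (@block_mulmx F n m s v).
Proof.
move=> a X Y; apply/rowP => j.
by rewrite mxE linearP !mxE.
Qed.

HB.instance Definition _ (F : fieldType) (n m s : nat)
    (v : 'I_s -> 'rV[F]_n) :=
  GRing.isLinear.Build F 'M[F]_(n, m) 'rV[F]_(\sum_(j < s) m) *:%R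
    (@block_mulmx F n m s v) (@block_mulmx_is_linear F n m s v).

Lemma row_m2 (F : finFieldType) (k n m : nat) (T : tensor F k n m)
    (u : 'rV[F]_n) (a : 'I_k) : row a (m2 u T) = u *m slice1 T a.
Proof. by apply/rowP => c; rewrite !mxE; apply: eq_bigr => b _; rewrite mxE. Qed.

Lemma rowsp_mxrow_m2 (F : finFieldType) (k n m s : nat)
    (C : {vspace 'M[F]_(n, m)}) (T : tensor F k n m) (v : 'I_s -> 'rV[F]_n) :
  generator_tensor C T ->
  rowsp (\mxrow_(j < s) m2 (v j) T) = (linfun (block_mulmx v) @: C)%VS.
Proof.
move=> <-; rewrite limg_span -map_comp /rowsp; congr span.
apply: eq_map => a /=; rewrite lfunE /= row_mxrow.
by apply/eq_mxrowP => j; apply: row_m2.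
Qed.

(** Orthogonality to a sum of lines can be tested on the generators [v j], and [v j] is orthogonal
    to every column of [X] exactly when [v j *m X = 0]. *)
Lemma subcode_orthov_span (F : finFieldType) (n m s : nat)
    (C : {vspace 'M[F]_(n, m)}) (v : 'I_s -> 'rV[F]_n) :
  subcode C (Defs.orthov (\sum_(j < s) <[v j]>)%VS)
    = (C :&: lker (linfun (block_mulmx v)))%VS.
Proof.
apply/vspaceP => X; rewrite mem_subcode memv_cap memv_ker lfunE /=.
congr (_ && _); apply/colsp_subP/eqP => [h|h w].
  rewrite /block_mulmx -[RHS]mxrow0; apply/eq_mxrowP => j.
  have hj c : v j *m (X *m c) = 0 :> 'M_1.
    move/mem_orthov: (h c) => /(_ (v j)); rewrite trmxK; apply.
    exact/(subvP (sumv_sup j _ (subvv _)))/memv_line.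
  (* The unit vector selects column [c] of [X], hence entry [c] of [v j *m X]. *)
  apply/rowP => c; move/matrixP: (hj (delta_mx c 0)) => /(_ 0 0).
  by rewrite mulmxA -colE !mxE.
have hj j : v j *m X = 0.
  by move: h; rewrite /block_mulmx -[X in _ = X]mxrow0 => /eq_mxrowP.
apply/mem_orthov => _ /memv_sumP[y yv ->]; rewrite trmxK mulmx_suml big1 // => j _.
by case/vlineP: (yv j isT) => a ->; rewrite -scalemxAl mulmxA hj mul0mx scaler0.
Qed.

Lemma code_rho_span (F : finFieldType) (k n m s : nat)
    (C : {vspace 'M[F]_(n, m)}) (T : tensor F k n m) (v : 'I_s -> 'rV[F]_n) :
  generator_tensor C T ->
  code_rho C (\sum_(j < s) <[v j]>)%VS
    = (\dim (rowsp (\mxrow_(j < s) m2 (v j) T)))%:R / m%:R.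
Proof.
move=> hT; rewrite (rowsp_mxrow_m2 v hT) /code_rho subcode_orthov_span.
(* Rank-nullity on [C]: the kernel term cancels and the image remains. *)
by rewrite -{1}(limg_ker_dim (linfun (block_mulmx v)) C) natrD addrAC subrr add0r.
Qed.

Theorem theorem3p6 (q : nat) (F : finFieldType) (hq : #|F| = q)
    (n m k N : nat) (hn : (2 <= n)%N) (hm : (1 <= m)%N)
    (C : {vspace 'M[F]_(n, m)}) (hC : nondegenerate_code C) (hk : \dim C = k)
    (T : tensor F k n m) (hT : generator_tensor C T)
    (hN : N = ((q ^ n - 1) %/ (q - 1))%N)
    (u : 'I_N -> 'rV[F]_n) (hu : forall i : 'I_N, u i != 0)
    (hrep : bijective (fun i : 'I_N => point_of (hu i)))
    (CAH : {vspace 'rV[F]_(\sum_(i < N) m)})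
    (hCAH : rowsp (\mxrow_(i < N) m2 (u i) T) = CAH) :
  exists psi : point F n -> 'I_N,
    (forall i : 'I_N, psi (point_of (hu i)) = i) /\
    polymatroid_equiv psi (Proj (code_qpolymatroid C))
      (induced_polymatroid hCAH).
Proof.
have [psi uK Ku] := hrep; exists psi; split=> //.
have psi_bij : bijective psi by exists (fun i => point_of (hu i)).
split=> // A; rewrite /= /block_rank.
(* It remains to see that the points of [A] and the [u i] with [i] in [psi @: A] span the same
   space. *)
rewrite -(code_rho_span (fun j => u (enum_val j)) hT); congr code_rho.
rewrite pspanE -(big_enum_val (A := mem (psi @: A)) (fun i => <[u i]>%VS)) /=.
rewrite big_imset /=; last by move=> P Q _ _; apply: bij_inj.
(* By [Ku], the point [P] is the line through [u (psi P)]. *)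
by apply: eq_bigr => P _; rewrite -[in LHS](Ku P).
Qed.
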